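(* Let $N\ge1$, $1\le C\le N$, $T\ge1$, $S\ge 1$ and $k\ge 0$ be integers, and let $x^T\in[N]^T$ be any file request sequence. Let $\pi_k^{\textsc{Sage}}(x^T)$ be the expected hit rate on $x^T$ of the online policy that runs the $k$-th order Markov state machine and, at each of its $N^k$ states, an independent copy of the \textsc{Sage} caching policy fed only with the requests arriving while the machine is in that state. Then $$T\big(\tilde{\pi}_S(x^T)-\pi_k^{\textsc{Sage}}(x^T)\big)\le T\min\Big(1-\frac CN,\sqrt{\frac{\ln S}{2(k+1)}}\Big)+\sqrt{2N^kCL^*_{T,k}\ln\frac{Ne}{C}}+N^kC\ln\frac{Ne}{C},$$ where $L^*_{T,k}$ is the minimum number of cache misses on $x^T$ incurred by any $k$-th order Markov prefetcher.
   Context: Caching setting: a library of $N$ unit-sized files $[N]$ and a cache holding $C$ files. In round $t$ a set of $C$ files is placed in the cache (possibly at random), then file $x_t\in[N]$ is requested; a cache hit (reward 1) occurs if $x_t$ is in the cache, otherwise reward 0. The hit rate of a policy on $x^T$ is its expected number of hits divided by $T$. A Finite State Prefetcher (FSP) is a quintuple $(\mathcal{S},[N],g,f,s_0)$: finite state set $\mathcal S$, transition $g:\mathcal S\times[N]\to\mathcal S$, possibly randomized prefetching function $f$ mapping each state to a set of $C$ files, initial state $s_0$; at round $t$ in state $s_t$ it caches $f(s_t)$, observes $x_t$, and moves to $g(s_t,x_t)$. $\tilde{\pi}_S(x^T)$ is the maximum hit rate on $x^T$ of any FSP with at most $S$ states. A $k$-th order Markov prefetcher is an FSP with state set $[N]^k$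 whose state at round $t$ is $(x_{t-1},\dots,x_{t-k})$, with the shift transition function (a single state if $k=0$). The \textsc{Sage} caching policy (run on a request stream $x_1,x_2,\dots$): maintain weights $w(i)=\exp(\eta R(i))$ where $R(i)$ is the number of past requests for file $i$ and $\eta>0$ is the learning rate; each round compute marginals $p(i)=w(i)\,e_{C-1}(\mathbf w_{-i})/e_C(\mathbf w)$, where $e_m$ is the elementary symmetric polynomial of order $m$ and $\mathbf w_{-i}$ omits coordinate $i$ (these are exactly the file-inclusion marginals of the Hedge algorithm with experts all $C$-subsets of $[N]$, expert $A$ earning reward $\mathbb 1(x_t\in A)$), and cache a random $C$-set with $\Pr(i\text{ cached})=p(i)$ via Madow's systematic sampling (draw $U\sim\mathrm{Unif}[0,1]$, set $P_0=0$, $P_i=P_{i-1}+p(i)$, and select for each $m=0,\dots,C-1$ the index $j$ with $P_{j-1}\le U+m\le P_j$). The learning rate is tuned adaptively (the standard small-loss tuning of Hedge) so that on every request sequence of length $n$ the policy's expected number of hits is at least the number of hits of the best fixed $C$-set minus $\sqrt{2C\,l^*\ln(Ne/C)}+C\ln(Ne/C)$, where $l^*$ is the number of misses of the best fixed $C$-set. *)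

(* Defs.v *)
From HB Require Import structures.
From mathcomp Require Import all_boot all_order all_algebra.
From mathcomp Require Import all_classical all_reals all_analysis.
Set Implicit Arguments. Unset Strict Implicit. Unset Printing Implicit Defensive.
Import Order.TTheory GRing.Theory Num.Theory.
Local Open Scope ring_scope.
Local Open Scope classical_set_scope.

(* Files are 'I_N.  A (possibly randomized) cache content is a probability
   distribution over C-subsets of 'I_N. *)
Definition is_cache_dist {R : realType} {N : nat} (C : nat)
  (d : {ffun {set 'I_N} -> R}) : Prop :=
  [/\ forall A, 0 <= d A, \sum_(A : {set 'I_N}) d A = 1
    & forall A, d A != 0 -> #|A| = C].

Definition hit_prob {R : realType} {N : nat} (d : {ffun {set 'I_N} -> R})
  (y : 'I_N) : R := \sum_(A : {set 'I_N} | y \in A) d A.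

Fixpoint fsp_hits {R : realType} {N : nat} {St : finType}
  (g : St -> 'I_N -> St) (f : St -> {ffun {set 'I_N} -> R}) (s : St)
  (x : seq 'I_N) : R :=
  match x with
  | [::] => 0
  | y :: ys => hit_prob (f s) y + fsp_hits g f (g s y) ys
  end.

Definition fsp_hit_rate {R : realType} {N : nat} {St : finType}
  (g : St -> 'I_N -> St) (f : St -> {ffun {set 'I_N} -> R}) (s0 : St)
  (x : seq 'I_N) : R := fsp_hits g f s0 x / (size x)%:R.

(* k-th order Markov state: s i = x_{t-1-i}; shift transition. *)
Definition markov_next {N k : nat} (s : {ffun 'I_k -> 'I_N}) (y : 'I_N)
  : {ffun 'I_k -> 'I_N} :=
  [ffun i : 'I_k => if val i is j.+1 then s (insubd i j) else y].

Definition esym {R : realType} {N : nat} (m : nat) (w : 'I_N -> R) : R :=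
  \sum_(A : {set 'I_N} | #|A| == m) \prod_(j in A) w j.
Definition esym_wo {R : realType} {N : nat} (m : nat) (w : 'I_N -> R)
  (i : 'I_N) : R :=
  \sum_(A : {set 'I_N} | (#|A| == m) && (i \notin A)) \prod_(j in A) w j.

(* SAGE: the learning rate eta h may depend on the past history h (adaptive
   tuning); weights w(i) = exp(eta * R(i)), R(i) = number of past requests of i. *)
Definition sage_weights {R : realType} {N : nat} (eta : seq 'I_N -> R)
  (h : seq 'I_N) (i : 'I_N) : R := expR (eta h * (count_mem i h)%:R).

(* Inclusion marginal p(i) = Pr(i cached) (Madow sampling realizes it). *)
Definition sage_marg {R : realType} {N : nat} (C : nat) (eta : seq 'I_N -> R)
  (h : seq 'I_N) (i : 'I_N) : R :=
  sage_weights eta h i * esym_wo C.-1 (sage_weights eta h) i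
    / esym C (sage_weights eta h).

Fixpoint sage_hits_from {R : realType} {N : nat} (C : nat)
  (eta : seq 'I_N -> R) (h : seq 'I_N) (x : seq 'I_N) : R :=
  match x with
  | [::] => 0
  | y :: ys => sage_marg C eta h y + sage_hits_from C eta (rcons h y) ys
  end.
Definition sage_hits {R : realType} {N : nat} (C : nat) (eta : seq 'I_N -> R)
  (x : seq 'I_N) : R := sage_hits_from C eta [::] x.

Definition best_fixed_hits {N : nat} (C : nat) (y : seq 'I_N) : nat :=
  \max_(A : {set 'I_N} | #|A| == C) count (fun z => z \in A) y.

Definition lnNeC {R : realType} (N C : nat) : R :=
  ln (N%:R * expR 1 / C%:R).

Definition sage_guarantee {R : realType} {N : nat} (C : nat)
  (eta : seq 'I_N -> R) : Prop :=
  forall y : seq 'I_N,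
    let b := best_fixed_hits C y in
    let l := (size y - b)%N in
    b%:R - Num.sqrt (2 * C%:R * l%:R * lnNeC N C) - C%:R * lnNeC N C
      <= sage_hits C eta y.

(* Expected hits of the k-th order Markov machine with an independent SAGE
   copy per state, each copy fed only with the requests arriving in its state.
   [past] records (state, request) pairs of previous rounds. *)
Fixpoint msage_hits {R : realType} {N k : nat} (C : nat) (eta : seq 'I_N -> R)
  (s : {ffun 'I_k -> 'I_N}) (past : seq ({ffun 'I_k -> 'I_N} * 'I_N))
  (x : seq 'I_N) : R :=
  match x with
  | [::] => 0
  | y :: ys =>
      sage_marg C eta [seq p.2 | p <- past & p.1 == s] y
      + msage_hits C eta (markov_next s y) (rcons past (s, y)) ys
  end.

Definition msage_hit_rate {R : realType} {N k : nat} (C : nat)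
  (eta : seq 'I_N -> R) (s0 : {ffun 'I_k -> 'I_N}) (x : seq 'I_N) : R :=
  msage_hits C eta s0 [::] x / (size x)%:R.

Definition Lstar {R : realType} {N k : nat} (C : nat)
  (s0 : {ffun 'I_k -> 'I_N}) (x : seq 'I_N) : R :=
  inf [set r : R | exists f : {ffun 'I_k -> 'I_N} -> {ffun {set 'I_N} -> R},
        (forall s, is_cache_dist C (f s)) /\
        r = (size x)%:R - fsp_hits (@markov_next N k) f s0 x].

(* Main.v *)
Require Import Defs.
From HB Require Import structures.
From mathcomp Require Import all_boot all_order all_algebra.
From mathcomp Require Import all_classical all_reals all_analysis.
From mathcomp Require Import ring lra zify.
Import Order.TTheory GRing.Theory Num.Theory.
Local Open Scope ring_scope.
Set Implicit Arguments. Unset Strict Implicit. Unset Printing Implicit Defensive.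

(* Let P be the number of hits of the best k-th order Markov prefetcher, which
   plays the best fixed C-set in each context. The guarantee of SAGE in each
   context and Cauchy-Schwarz give P minus the two regret terms, so it remains to
   compare the hits F of the finite state prefetcher with P. Averaging over all
   C-sets gives P >= T C / N, hence the bound 1 - C / N.

   For the other bound put n = k + 1 and e = sqrt (ln S / (2 n)), and run Hedge
   with rate 4 e on every window of n consecutive requests, the experts being the
   S possible states of the prefetcher at the start of the window. The distribution
   that Hedge uses at position j of a window depends only on the last j requests, so
   its average over j < n is a Markov policy of order k, whose hits are at most P.
   Hedge loses at most n e per window, and there are T windows.

   The windows that would start before the first request are not covered by this
   argument, which costs up to k / 2 hits. These are recovered as follows. In the
   last round of a window the regret is also at most 1 - v, v being the weight of
   the good expert, so that each window loses less than n e by a definite amount,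
   and in total an amount proportional to T. If nevertheless F - P > T e, then P
   has more than T e misses, and either the two regret terms already exceed
   (1 - e) T, in which case F <= T suffices, or T is at least
   N^k C ln (N e / C) (1 + sqrt (e (2 - e))) / (1 - e)^2, which is so large that
   the gain outweighs k / 2. *)

(** * Logarithmic and exponential inequalities *)

Section real_inequalities.
Import numFieldNormedType.Exports.

Lemma is_derive_ge0_le (R : realType) (f df : R -> R) (a b : R) :
  a <= b -> (forall x, a <= x -> is_derive x 1 f (df x)) ->
  (forall x, a <= x -> 0 <= df x) -> f a <= f b.
Proof.
move=> ab fd df0; rewrite -subr_ge0.
have [||c cab ->] := @MVT_segment R f df a b ab.
- by move=> x; rewrite in_itv/= => /andP[ax _]; apply: fd; exact: ltW.
- apply: derivable_within_continuous => x; rewrite in_itv/= => /andP[ax _].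
  by have [] := fd x ax.
- by move: cab; rewrite in_itv/= => /andP[ac _]; rewrite mulr_ge0 ?subr_ge0 ?df0.
Qed.

(** The difference of the two sides vanishes at 1 and has derivative [(x - 1)^2 / (x (x + 1)^2)]. *)
Lemma ln_ge_pade (R : realType) (x : R) : 1 <= x -> 2 * (x - 1) / (x + 1) <= ln x.
Proof.
move=> x1; pose f (y : R) : R := ln y - 2 * (y - 1) * (y + 1)^-1.
pose df (y : R) : R := y^-1 - 4 * ((y + 1)^-1) ^+ 2.
suff : f 1 <= f x by rewrite /f ln1 subrr mulr0 mul0r subrr subr_ge0.
apply: (@is_derive_ge0_le R f df) => // y y1.
- have y0 : 0 < y by lra.
  have y10 : y + 1 != 0 by lra.
  rewrite /f /df.
  have H1 := is_derive1_ln y0.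
  have H2 : is_derive y 1 (fun z : R => (z + 1)^-1) (- (y + 1) ^- 2 *: (1 + 0)).
    by apply: is_deriveV.
  have H3 : is_derive y 1 (fun z : R => 2 * (z - 1)) (2 *: (1 - 0)).
    by apply: is_deriveZ.
  have H4 := is_deriveB H1 (is_deriveM H3 H2).
  apply: is_derive_eq; rewrite /GRing.scale/= -exprVn.
  field; lra.
- rewrite /df subr_ge0.
  have y0 : 0 < y by lra.
  rewrite exprVn ler_pdivrMr; last by apply: exprn_gt0; lra.
  rewrite mulrC ler_pdivlMr//.
  have := sqr_ge0 (y - 1); nra.
Qed.

Lemma ln2_gt (R : realType) : 691 / 1000 <= ln 2 :> R.
Proof.
(* Applied at 2 directly, [ln_ge_pade] gives only 2/3; factors close to 1 lose far less. *)
have -> : ln 2 = ln (5/4) + (ln (6/5) + (ln (7/6) + ln (8/7))) :> R.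
  have e1 : (2 : R) = (5/4) * ((6/5) * ((7/6) * (8/7))) by field.
  by rewrite {1}e1 (@lnM _ (5/4)) ?posrE ?(@lnM _ (6/5)) ?posrE ?(@lnM _ (7/6)) ?posrE //; lra.
have h1 : 2 / 9 <= ln (5/4) :> R.
  by apply: le_trans (@ln_ge_pade R (5/4) _); [rewrite le_eqVlt; apply/orP; left; apply/eqP; field|lra].
have h2 : 2 / 11 <= ln (6/5) :> R.
  by apply: le_trans (@ln_ge_pade R (6/5) _); [rewrite le_eqVlt; apply/orP; left; apply/eqP; field|lra].
have h3 : 2 / 13 <= ln (7/6) :> R.
  by apply: le_trans (@ln_ge_pade R (7/6) _); [rewrite le_eqVlt; apply/orP; left; apply/eqP; field|lra].
have h4 : 2 / 15 <= ln (8/7) :> R.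
  by apply: le_trans (@ln_ge_pade R (8/7) _); [rewrite le_eqVlt; apply/orP; left; apply/eqP; field|lra].
by lra.
Qed.

(** The tangent of [expR] at [c * h] lies below the graph at [0] and at [c]; these two bounds are
    averaged with weights [1 - h] and [h]. *)
Lemma expR_le_chord (R : realType) (c h : R) : 0 <= h -> h <= 1 ->
  expR (c * h) <= 1 - h + h * expR c.
Proof.
move=> h0 h1.
have e0 := expR_gt0 (c * h).
have -> : expR c = expR (c * h) * expR (c * (1 - h)) by rewrite -expRD; congr expR; ring.
have H1 : 1 - c * h <= (expR (c * h))^-1 by rewrite -expRN; have := expR_ge1Dx (- (c * h)); lra.
have H2 := expR_ge1Dx (c * (1 - h)).
have : (1 - h) * (1 - c * h) + h * (1 + c * (1 - h)) <=
  (1 - h) * (expR (c * h))^-1 + h * expR (c * (1 - h)).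
  by apply: lerD; apply: ler_wpM2l => //; lra.
have -> : (1 - h) * (1 - c * h) + h * (1 + c * (1 - h)) = 1 by ring.
rewrite -(ler_pM2l e0) mulr1 mulrDr.
by rewrite [_ * (_ * _^-1)]mulrCA divff ?gt_eqF// mulr1 mulrCA.
Qed.

(** Hoeffding's lemma for a Bernoulli variable: the second derivative of the logarithm of the
    left-hand side is the variance of a tilted Bernoulli variable, hence at most 1/4. Derivatives
    are compared twice, from 0. *)
Lemma bernoulli_mgf_le (R : realType) (p c : R) : 0 <= p -> p <= 1 -> 0 <= c ->
  1 - p + p * expR c <= expR (c * p + c ^+ 2 / 8).
Proof.
move=> p0 p1 c0.
pose D (x : R) : R := 1 - p + p * expR x.
have D1 (x : R) : 0 <= x -> 1 <= D x.
  by move=> x0; rewrite /D; have := expR_ge1Dx x; nra.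
have D0 (x : R) : 0 <= x -> 0 < D x by move=> x0; have := D1 x x0; lra.
have dE (x : R) : is_derive x 1 (fun z : R => p * expR z) (p * expR x).
  by apply: (@is_deriveZ R R^o R^o expR p x 1 (expR x)).
have dD (x : R) : is_derive x 1 D (p * expR x).
  have H : is_derive x 1 D (0 + p *: expR x).
    by apply: is_deriveD; apply: is_deriveZ.
  by apply: is_derive_eq; rewrite add0r.
have r0 (x : R) : 0 <= x -> 0 <= p + x / 4 - p * expR x * (D x)^-1.
  move=> x0.
  pose r (y : R) : R := p + y / 4 - p * expR y * (D y)^-1.
  suff : r 0 <= r x by rewrite {1}/r /D expR0 mulr1 subrK invr1 mul0r mulr1 addr0 subrr.
  apply: (@is_derive_ge0_le R r
    (fun y => 1 / 4 - (p * expR y * (1 - p)) / (D y) ^+ 2)); [exact: x0|move=> y y0..].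
  - have Dy : D y != 0 by rewrite gt_eqF ?D0.
    have H1 : is_derive y 1 (fun z : R => p + z / 4) (0 + 4^-1 *: 1).
      apply: is_deriveD; rewrite [X in is_derive _ _ X _](_ : _ = 4^-1 *: (id : R -> R)).
        exact: is_deriveZ.
      by apply/funext => z /=; rewrite mulrC.
    have H2 := is_deriveV Dy (dD y).
    have H3 := is_deriveB H1 (is_deriveM (dE y) H2).
    apply: is_derive_eq; rewrite /GRing.scale/=.
    have eD : D y = 1 - p + p * expR y by [].
    move: (D y) Dy eD => d Dy eD; have -> : p * expR y = d - (1 - p) by rewrite eD; ring.
    by field.
  - rewrite subr_ge0 ler_pdivrMr ?exprn_gt0 ?D0//.
    rewrite /D; have := sqr_ge0 (1 - p - p * expR y); nra.
have : 0 <= c * p + c * c / 8 - ln (D c).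
  pose G (y : R) : R := y * p + y * y / 8 - ln (D y).
  suff : G 0 <= G c by rewrite {1}/G /D expR0 mulr1 subrK ln1 !mul0r addr0 subrr.
  apply: (@is_derive_ge0_le R G (fun y => p + y / 4 - p * expR y * (D y)^-1)); [exact: c0|move=> y y0|exact: r0].
  have H1 : is_derive y 1 (fun z : R => z * p + z * z / 8) (p *: 1 + 8^-1 *: (y *: 1 + y *: 1)).
    have Hid : is_derive y 1 (id : R -> R) 1 by exact: is_derive_id.
    have Hc (q : R) : is_derive y 1 (cst q : R -> R) 0 by exact: is_derive_cst.
    have := is_deriveD (is_deriveM Hid (Hc p)) (is_deriveM (is_deriveM Hid Hid) (Hc 8^-1)).
    by rewrite !scaler0 !add0r.
  have H2 := is_derive1_comp (is_derive1_ln (D0 y y0)) (dD y).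
  have H3 := is_deriveB H1 H2.
  apply: is_derive_eq; rewrite /GRing.scale/=.
  by rewrite /=; move: (D y)^-1 => d; field.
rewrite subr_ge0 => H.
by rewrite -[1 - p + _]/(D c) -(lnK (D0 c c0)) ler_expR expr2.
Qed.

End real_inequalities.

(** * Numerical comparison of the gain with the boundary loss *)

(* An upper bound of [ln v / c + 1 - v] over [0 < v <= 1]: the maximum is at
   [v = 1 / c] when [1 < c], and there [ln c >= 2 (c - 1) / (c + 1)] is used. *)
Definition last_round_bound {R : realFieldType} (c : R) : R :=
  if c <= 1 then 0 else (c - 1) ^+ 2 / (c * (c + 1)).

(* The products below are the degree-4 Bernstein basis of [a, b]. *)
Lemma bernstein4_ge0 (R : realFieldType) (a b e : R) : a <= e -> e <= b ->
  [/\ 0 <= (b - e) ^+ 4, 0 <= (e - a) * (b - e) ^+ 3,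
      0 <= (e - a) ^+ 2 * (b - e) ^+ 2, 0 <= (e - a) ^+ 3 * (b - e)
    & 0 <= (e - a) ^+ 4].
Proof.
by move=> ae eb; split; rewrite ?mulr_ge0 ?exprn_ge0 ?subr_ge0.
Qed.

(* In the next three lemmas the cubic is
   [4 e (4 e + 1) (e / 2 - last_round_bound (4 * e))], the constant [3/5], [2/3] or
   [7/10] bounds [sqrt (e (2 - e))] from below, [27/16] bounds [1 + ln 2], and the
   left-hand factor [c = 1, 5/4, 3/2] satisfies [k (k + 1) <= c 2 ^ k] for the
   [k] concerned. *)
Lemma start_poly_ge1 (R : realFieldType) (e : R) : 1/4 <= e -> e <= 1 ->
  (1 - e) ^+ 2 * (4 * e * (4 * e + 1)) <=
  2 * (27/16) * (1 + 3/5) * (8 * e ^+ 3 - 14 * e ^+ 2 + 8 * e - 1).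
Proof. by move=> h0 h1; have [*] := bernstein4_ge0 h0 h1; lra. Qed.

Lemma start_poly_ge2 (R : realFieldType) (e : R) : 6/23 <= e -> e <= 1 ->
  (5/4) * (1 - e) ^+ 2 * (4 * e * (4 * e + 1)) <=
  2 * (27/16) * (1 + 2/3) * (8 * e ^+ 3 - 14 * e ^+ 2 + 8 * e - 1).
Proof. by move=> h0 h1; have [*] := bernstein4_ge0 h0 h1; lra. Qed.

Lemma start_poly_ge3 (R : realFieldType) (e : R) : 7/24 <= e -> e <= 1 ->
  (3/2) * (1 - e) ^+ 2 * (4 * e * (4 * e + 1)) <=
  2 * (27/16) * (1 + 7/10) * (8 * e ^+ 3 - 14 * e ^+ 2 + 8 * e - 1).
Proof.
move=> h0 h1; have [h2|/ltW h2] := leP e (5/8).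
  by have [*] := bernstein4_ge0 h0 h2; lra.
by have [*] := bernstein4_ge0 h2 h1; lra.
Qed.

Section numerics.
Variable R : rcfType.
Implicit Types (e T Q : R) (k : nat).

(** Squaring the hypothesis and completing the square gives [y^2 > Q^2 e (2 - e)] for
    [y = (1 - e)^2 T - Q]. The negative branch is excluded by [y > - Q e] and
    [e <= sqrt (e (2 - e))]. *)
Lemma horizon_ge e T Q : 0 < e -> e < 1 -> 0 <= T -> 0 < Q ->
  Q + Num.sqrt (2 * Q * (e * T)) < (1 - e) * T ->
  Q * (1 + Num.sqrt (e * (2 - e))) <= (1 - e) ^+ 2 * T.
Proof.
move=> e0 e1 T0 Q0.
have h2 : 0 <= 2 * Q * (e * T) by rewrite !mulr_ge0// ltW.
have h3 : 0 <= e * (2 - e) by rewrite mulr_ge0//; lra.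
set r := Num.sqrt (2 * _ * _); set s := Num.sqrt _ => lt.
have r0 : 0 <= r by exact: sqrtr_ge0.
have s0 : 0 <= s by exact: sqrtr_ge0.
have er : r ^+ 2 = 2 * Q * (e * T) by exact: sqr_sqrtr.
have es : s ^+ 2 = e * (2 - e) by exact: sqr_sqrtr.
clearbody r s.
have lt2 : r ^+ 2 < ((1 - e) * T - Q) ^+ 2.
  have := lt; rewrite -ltrBrDl => lt1.
  by rewrite ltr_pXn2r ?nnegrE// (le_trans r0)// ltW.
have es1 : e <= s by rewrite -(@ler_pXn2r _ 2) ?nnegrE ?es//; nra.
rewrite leNgt; apply/negP => ltU.
have lbT : Q * (1 - e) < (1 - e) ^+ 2 * T by nra.
have leQ : Q * (1 - s) <= Q * (1 - e) by rewrite ler_pM2l//; lra.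
have : 0 < (Q * s - ((1 - e) ^+ 2 * T - Q)) * (Q * s + ((1 - e) ^+ 2 * T - Q)).
  by rewrite mulr_gt0//; lra.
have -> : (Q * s - ((1 - e) ^+ 2 * T - Q)) * (Q * s + ((1 - e) ^+ 2 * T - Q)) =
  Q ^+ 2 * s ^+ 2 - ((1 - e) ^+ 2 * T - Q) ^+ 2 by ring.
have : 0 < (1 - e) ^+ 2 * (((1 - e) * T - Q) ^+ 2 - r ^+ 2).
  by rewrite mulr_gt0 ?exprn_gt0//; lra.
rewrite er es.
have -> : (1 - e) ^+ 2 * (((1 - e) * T - Q) ^+ 2 - 2 * Q * (e * T)) =
  ((1 - e) ^+ 2 * T - Q) ^+ 2 - Q ^+ 2 * (e * (2 - e)) by ring.
lra.
Qed.

Lemma quad_le_exp2 k : (5 <= k)%N -> (k * k.+1 <= 2 ^ k)%N.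
Proof.
elim: k => // k IH; rewrite leq_eqVlt => /predU1P[<-//|k5].
by have := IH k5; rewrite expnS; nia.
Qed.

Lemma cube_le_exp2 k : (6 <= k)%N -> (k * k.+1 ^ 2 <= 5 * 2 ^ k)%N.
Proof.
elim: k => // k IH; rewrite leq_eqVlt => /predU1P[<-//|k5].
have h : (k.+2 ^ 2 <= 2 * (k * k.+1))%N by rewrite expnS expn1; nia.
rewrite [(2 ^ k.+1)%N]expnS mulnCA (@leq_trans (2 * (k * k.+1 ^ 2)))//.
  apply: (leq_trans (leq_mul (leqnn k.+1) h)); rewrite !expnS; nia.
by rewrite leq_mul2l IH.
Qed.

(** This is [boundary_absorbed] at the least [T] that [horizon_ge] allows, cleared of the
    denominator [(1 - e)^2]. The constant [11/16] is a lower bound of [ln 2]. *)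
Lemma boundary_loss_le_gain e Q k : 0 < e -> e < 1 ->
  11/16 <= 2 * (k.+1)%:R * e ^+ 2 -> (27/16) * 2 ^+ k <= Q ->
  (k * k.+1)%:R * (1 - e) ^+ 2 <=
  2 * Q * (1 + Num.sqrt (e * (2 - e))) * (e / 2 - last_round_bound (4 * e)).
Proof.
move=> e0 e1 he hQ.
have h3 : 0 <= e * (2 - e) by rewrite mulr_ge0//; lra.
have es := sqr_sqrtr h3; have s0 := sqrtr_ge0 (e * (2 - e)).
move: (Num.sqrt _) es s0 => s es s0.
have s_ge (b c : R) : 0 <= b -> c <= e -> c <= 1 -> b ^+ 2 <= c * (2 - c) -> b <= s.
  by move=> b0 ce c1 bc; rewrite -(@ler_pXn2r _ 2) ?nnegrE// es; nra.
have p2 : 0 < 2 ^+ k :> R by exact: exprn_gt0.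
have kR m : (k * k.+1 <= m)%N -> (k * k.+1)%:R <= m%:R :> R by rewrite ler_nat.
rewrite /last_round_bound; case: ifPn => [he4|].
  rewrite subr0.
  (* With [e <= 1/4], [he] forces [k >= 5]. The inequality of [cube_le_exp2] fails at 5, so that
     value is treated apart. *)
  have [k6|k5] : (6 <= k)%N \/ k = 5.
    have : 5 < (k.+1)%:R :> R by clear -he he4 e0; nra.
    by rewrite ltr_nat ltnS leq_eqVlt => /orP[/eqP|]; auto.
  - have k1 : 0 < (k.+1)%:R :> R by rewrite ltr0n.
    have : (k * k.+1 ^ 2)%:R <= 5 * 2 ^+ k :> R.
      by rewrite -natrX -natrM ler_nat; exact: cube_le_exp2.
    rewrite expnS expn1 mulnA natrM => hk.
    (* [21/8] is admissible because [e <= 1/4]. Then [37/8 = 21/8 + 2] makes [21/8] the linear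
       coefficient of [(1 + 37/8 e) (1 - e)^2], whose higher terms are negative in total. *)
    have s26 : (21/8) * e <= s.
      by rewrite -(@ler_pXn2r _ 2) ?nnegrE ?es//; clear -e0 he4; nra.
    have {}Hk : (k * k.+1)%:R <= Q * (e * (1 + (37/8) * e)).
      have h1 : 5 / (k.+1)%:R <= (27/16) * (e * (1 + (37/8) * e)).
        by rewrite ler_pdivrMr//; nra.
      have h2 : (k * k.+1)%:R <= 5 / (k.+1)%:R * 2 ^+ k :> R.
        by rewrite mulrAC ler_pdivlMr.
      apply: (le_trans h2); apply: (@le_trans _ _ (27/16 * 2 ^+ k * (e * (1 + 37/8 * e)))).
        by rewrite -[leRHS]mulrA [2 ^+ k * _]mulrC mulrA ler_wpM2r// ltW.
      by rewrite ler_wpM2r//; nra.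
    have H1 : (1 + (37/8) * e) * (1 - e) ^+ 2 <= 1 + s by nra.
    apply: (@le_trans _ _ (Q * (e * (1 + (37/8) * e)) * (1 - e) ^+ 2)).
      by rewrite ler_wpM2r// sqr_ge0.
    have -> : Q * (e * (1 + 37 / 8 * e)) * (1 - e) ^+ 2 =
      (Q * e) * ((1 + (37/8) * e) * (1 - e) ^+ 2) by ring.
    have -> : 2 * Q * (1 + s) * (e / 2) = (Q * e) * (1 + s) by field.
    by rewrite ler_wpM2l//; nra.
  - subst k; rewrite -[(5 * 6)%:R]/(30%:R) in kR *.
    have el : 4/17 <= e.
      by rewrite -(@ler_pXn2r _ 2) ?nnegrE//; clear -e0 he; nra.
    have sl : 3/5 <= s by apply: (s_ge _ (4/17)) => //; clear -el; lra.
    have qe : 54 * (4/17) <= Q * e by clear -hQ el; nra.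
    have h1 : 54 * (4/17) * (1 + 3/5) <= Q * e * (1 + s) by clear -qe sl; nra.
    by clear -h1 el e0 e1; nra.
rewrite -ltNge => he4.
have -> : e / 2 - (4 * e - 1) ^+ 2 / (4 * e * (4 * e + 1)) =
  (8 * e ^+ 3 - 14 * e ^+ 2 + 8 * e - 1) / (4 * e * (4 * e + 1)).
  by field; lra.
have d0 : 0 < 4 * e * (4 * e + 1) by rewrite mulr_gt0//; lra.
rewrite mulrA ler_pdivlMr//.
(* Each [c] is the largest ratio [k (k + 1) / 2^k] of its case. The bounds [6/23] and [7/24] on [e]
   come from [he] with [k = 4] and [k <= 3]; [1/4] is the case assumption. *)
have [c [s1 [c0 hc s10 s1s H]]] : exists c s1 : R,
    [/\ 0 < c, (k * k.+1)%:R <= c * 2 ^+ k, 0 <= s1, s1 <= s &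
    c * (1 - e) ^+ 2 * (4 * e * (4 * e + 1)) <=
    2 * (27/16) * (1 + s1) * (8 * e ^+ 3 - 14 * e ^+ 2 + 8 * e - 1)].
  have [k4|[k23|k1]] : k = 4 \/ (k = 2 \/ k = 3) \/ (k * k.+1 <= 2 ^ k)%N.
  - have [/quad_le_exp2|] := leqP 5 k; first by right; right.
    by case: (k) => [|[|[|[|[|k']]]]]; auto.
  - exists (5/4), (2/3); have el : 6/23 <= e.
      by rewrite -(@ler_pXn2r _ 2) ?nnegrE//; subst k; clear -e0 he; nra.
    split; [clear; lra| |clear; lra| |by apply: start_poly_ge2; clear -el e1; lra].
    + by subst k; rewrite natrM; clear; lra.
    + by apply: (s_ge _ (6/23)) => //; clear -el; lra.
  - exists (3/2), (7/10); have el : 7/24 <= e.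
      by rewrite -(@ler_pXn2r _ 2) ?nnegrE//; clear -e0 he k23; case: k23 => ?; subst k; nra.
    split; [clear; lra| |clear; lra| |by apply: start_poly_ge3; clear -el e1; lra].
    + by case: k23 => ?; subst k; rewrite natrM; clear; lra.
    + by apply: (s_ge _ (7/24)) => //; clear -el; lra.
  - exists 1, (3/5); have el : 1/4 <= e by lra.
    split; [clear; lra| |clear; lra| |by rewrite mul1r; apply: start_poly_ge1; clear -el e1; lra].
    + by rewrite mul1r -natrX ler_nat.
    + by apply: (s_ge _ (1/4)) => //; clear -el; lra.
have P0 : 0 <= 8 * e ^+ 3 - 14 * e ^+ 2 + 8 * e - 1.
  have : 0 <= c * (1 - e) ^+ 2 * (4 * e * (4 * e + 1)).
    by apply: mulr_ge0 (ltW d0); apply: mulr_ge0 (sqr_ge0 _); exact: ltW.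
  move=> /le_trans/(_ H); rewrite pmulr_rge0// mulr_gt0//; clear -s10; lra.
have X0 := sqr_ge0 (1 - e).
move: ((1 - e) ^+ 2) (8 * _ - _ + _ - _) (4 * e * _) X0 P0 d0 H => X P d X0 P0 d0 H.
apply: (@le_trans _ _ (2 ^+ k * (c * X * d))).
  rewrite [leRHS](_ : _ = c * 2 ^+ k * (X * d)); last by ring.
  by rewrite -[leLHS]mulrA ler_wpM2r// mulr_ge0// ltW.
apply: (@le_trans _ _ (2 ^+ k * (2 * (27 / 16) * (1 + s1) * P))).
  by rewrite ler_wpM2l// ltW.
rewrite mulrA ler_wpM2r//.
have -> : 2 ^+ k * (2 * (27 / 16) * (1 + s1)) = 2 * (27 / 16 * 2 ^+ k) * (1 + s1) by ring.
by rewrite ler_pM//; lra.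
Qed.

(* When the regret terms of SAGE do not already cover all
   [T] requests, [T] is so large that what the last round of each window saves
   covers the [k / 2] hits lost at the start. *)
Lemma boundary_absorbed e T Q k : 0 < e -> e < 1 -> 0 <= T ->
  11/16 <= 2 * (k.+1)%:R * e ^+ 2 -> (27/16) * 2 ^+ k <= Q ->
  Q + Num.sqrt (2 * Q * (e * T)) < (1 - e) * T ->
  (k * k.+1)%:R <= 2 * T * (e / 2 - last_round_bound (4 * e)).
Proof.
move=> e0 e1 T0 he hQ lt.
have Q0 : 0 < Q by apply: lt_le_trans hQ; rewrite mulr_gt0 ?exprn_gt0//; lra.
have H1 := horizon_ge e0 e1 T0 Q0 lt.
have H2 := boundary_loss_le_gain e0 e1 he hQ.
have s0 := sqrtr_ge0 (e * (2 - e)).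
move: (Num.sqrt (e * (2 - e))) s0 H1 H2 => s s0 H1 H2.
have g0 : 0 <= e / 2 - last_round_bound (4 * e).
  have : 0 <= (k * k.+1)%:R * (1 - e) ^+ 2 by rewrite mulr_ge0 ?sqr_ge0.
  by move=> /le_trans/(_ H2); rewrite pmulr_rge0// !mulr_gt0//; lra.
have a0 : 0 < (1 - e) ^+ 2 by rewrite exprn_gt0//; lra.
rewrite -(ler_pM2r a0) (le_trans H2)//.
have -> : 2 * T * (e / 2 - last_round_bound (4 * e)) * (1 - e) ^+ 2 =
  2 * ((1 - e) ^+ 2 * T) * (e / 2 - last_round_bound (4 * e)) by ring.
by rewrite ler_wpM2r// -[leLHS]mulrA ler_pM2l.
Qed.
End numerics.

(** * SAGE along the contexts of a Markov machine *)

(** Cauchy-Schwarz: the squared sum is expanded over pairs, and each product is at most the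
    arithmetic mean. *)
Lemma sum_sqrt_le (R : rcfType) (I : finType) (a : I -> R) :
  (forall i, 0 <= a i) ->
  \sum_i Num.sqrt (a i) <= Num.sqrt (#|I|%:R * \sum_i a i).
Proof.
move=> a0; set S := \sum_i _.
have S0 : 0 <= S by apply: sumr_ge0 => i _; exact: sqrtr_ge0.
rewrite -[S]ger0_norm// -sqrtr_sqr ler_wsqrtr//.
have -> : S ^+ 2 = \sum_i \sum_j Num.sqrt (a i) * Num.sqrt (a j).
  by rewrite expr2 mulr_suml; apply: eq_bigr => i _; rewrite mulr_sumr.
have -> : #|I|%:R * \sum_i a i = \sum_i \sum_j (a i + a j) / 2.
  have E : \sum_i \sum_(j : I) a i = #|I|%:R * \sum_i a i.
    by rewrite mulr_sumr; apply: eq_bigr => i _; rewrite sumr_const mulr_natl.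
  transitivity ((\sum_i \sum_(j : I) a i + \sum_(i : I) \sum_j a j) / 2).
    by rewrite [X in _ + X]exchange_big/= E; lra.
  rewrite -big_split/= mulr_suml; apply: eq_bigr => i _.
  by rewrite -big_split/= mulr_suml.
apply: ler_sum => i _; apply: ler_sum => j _.
have := sqr_ge0 (Num.sqrt (a i) - Num.sqrt (a j)).
by have := sqr_sqrtr (a0 i); have := sqr_sqrtr (a0 j); nra.
Qed.

Lemma sum_hit_prob_le (R : realType) (N C : nat) (d : {ffun {set 'I_N} -> R})
    (ys : seq 'I_N) : is_cache_dist C d ->
  \sum_(y <- ys) hit_prob d y <= (best_fixed_hits C ys)%:R.
Proof.
case=> d0 d1 dC.
have -> : \sum_(y <- ys) hit_prob d y =
    \sum_(A : {set 'I_N}) d A * (count (fun z => z \in A) ys)%:R.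
  under eq_bigr do rewrite /hit_prob big_mkcond.
  rewrite exchange_big/=; apply: eq_bigr => A _.
  by rewrite -big_mkcond/= big_const_seq iter_addr_0 mulr_natr.
rewrite -[leRHS]mul1r -d1 mulr_suml; apply: ler_sum => A _.
have [->|dA] := eqVneq (d A) 0; first by rewrite !mul0r.
rewrite ler_wpM2l// d1 ler_nat; apply: (leq_bigmax_cond A).
exact/eqP/dC.
Qed.

Lemma hit_prob_ge0 (R : realType) (N C : nat) (d : {ffun {set 'I_N} -> R}) y :
  is_cache_dist C d -> 0 <= hit_prob d y.
Proof. by case=> d0 _ _; apply: sumr_ge0. Qed.

Lemma hit_prob_le1 (R : realType) (N C : nat) (d : {ffun {set 'I_N} -> R}) y :
  is_cache_dist C d -> hit_prob d y <= 1.
Proof.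
case=> d0 d1 _; rewrite -d1 [leRHS](bigID (fun A : {set 'I_N} => y \in A))/= lerDl.
exact: sumr_ge0.
Qed.

Lemma card_sets_mem (N C : nat) (y : 'I_N.+1) :
  #|[set A : {set 'I_N.+1} | (#|A| == C.+1) && (y \in A)]| = 'C(N, C).
Proof.
have -> : 'C(N, C) = ('C(N.+1, C.+1) - 'C(N, C.+1))%N by rewrite binS addKn.
have -> : 'C(N.+1, C.+1) = #|[set A : {set 'I_N.+1} | #|A| == C.+1]| by rewrite card_draws card_ord.
have -> : 'C(N, C.+1) = #|[set A : {set 'I_N.+1} | (A \subset ~: [set y]) && (#|A| == C.+1)]|.
  by rewrite cards_draws cardsC1 card_ord.
rewrite -(cardsID [set A : {set 'I_N.+1} | y \in A] [set A : {set 'I_N.+1} | #|A| == C.+1]).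
rewrite (_ : _ :\: _ = [set A : {set 'I_N.+1} | (A \subset ~: [set y]) && (#|A| == C.+1)]); last first.
  by apply/setP => A; rewrite !inE -finset.disjoints_subset disjoint_sym disjoints1.
by rewrite addnK; apply: eq_card => A; rewrite !inE.
Qed.

(** Double counting: each request lies in a fraction [C / N] of all [C]-sets, and the best set does
    at least as well as the average one. *)
Lemma best_fixed_hits_ge (N C : nat) (ys : seq 'I_N) :
  (0 < C)%N -> (C <= N)%N -> (C * size ys <= N * best_fixed_hits C ys)%N.
Proof.
case: N ys => [|N] ys; first by case: C.
case: C => // C _ CN.
set b := best_fixed_hits _ _.
have : (\sum_(A : {set 'I_N.+1} | #|A| == C.+1) count (fun z => z \in A) ys <=
    'C(N.+1, C.+1) * b)%N.
  have -> : ('C(N.+1, C.+1) * b = \sum_(A : {set 'I_N.+1} | #|A| == C.+1) b)%N.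
    rewrite sum_nat_const -[N.+1 in LHS]card_ord -card_draws; congr (_ * _)%N.
    by apply: eq_card => A; rewrite !inE.
  by apply: leq_sum => A AC; apply: leq_bigmax_cond.
have -> : (\sum_(A : {set 'I_N.+1} | #|A| == C.+1) count (fun z => z \in A) ys =
    'C(N, C) * size ys)%N.
  under eq_bigr do rewrite -sum1_count big_mkcond.
  rewrite exchange_big/= -sum1_size big_distrr/=; apply: eq_bigr => y _.
  rewrite -big_mkcondr sum1_card muln1 -(card_sets_mem C y).
  by apply: eq_card => A; rewrite !inE.
rewrite -(leq_pmul2l (ltn0Sn C)) mulnA [(C.+1 * ('C(_, _) * _))%N]mulnA -mul_bin_diag /=.
rewrite mulnAC -!mulnA.
have B0 : (0 < 'C(N, C))%N by rewrite bin_gt0.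
by move=> H; rewrite -(leq_pmul2l B0); lia.
Qed.

Section trace.
Variables (N k : nat).
Notation state := {ffun 'I_k -> 'I_N}.

Fixpoint markov_trace (s : state) (x : seq 'I_N) : seq (state * 'I_N) :=
  if x is y :: ys then (s, y) :: markov_trace (markov_next s y) ys else [::].

Definition requests_at (tr : seq (state * 'I_N)) (s : state) : seq 'I_N :=
  [seq p.2 | p <- tr & p.1 == s].

Lemma size_markov_trace s x : size (markov_trace s x) = size x.
Proof. by elim: x s => //= y ys IH s; rewrite IH. Qed.

Lemma sum_requests_at (M : nmodType) (F : state -> 'I_N -> M) tr :
  \sum_(p <- tr) F p.1 p.2 = \sum_s \sum_(y <- requests_at tr s) F s y.
Proof.
transitivity (\sum_s \sum_(p <- tr | p.1 == s) F p.1 p.2).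
  rewrite (exchange_big_dep predT)//=; apply: eq_bigr => p _.
  by rewrite (big_pred1 p.1).
apply: eq_bigr => s _; rewrite big_map big_filter.
by apply: eq_bigr => p /eqP ->.
Qed.

Lemma sum_size_requests_at tr : (\sum_s size (requests_at tr s) = size tr)%N.
Proof.
have := @sum_requests_at nat (fun _ _ => 1%N) tr.
rewrite sum1_size => ->; apply: eq_bigr => s _; exact/esym/sum1_size.
Qed.

Variable R : realType.

Lemma fsp_hits_markov (f : state -> {ffun {set 'I_N} -> R}) s x :
  fsp_hits (@markov_next N k) f s x =
  \sum_(p <- markov_trace s x) hit_prob (f p.1) p.2.
Proof.
by elim: x s => [|y ys IH] s /=; rewrite ?big_nil// big_cons IH.
Qed.

Variables (C : nat) (eta : seq 'I_N -> R).

Lemma sage_hits_from_rcons h x y : sage_hits_from C eta h (rcons x y) =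
  sage_hits_from C eta h x + sage_marg C eta (h ++ x) y.
Proof.
elim: x h => [|z x IH] h /=; first by rewrite cats0 addr0 add0r.
by rewrite IH cat_rcons addrA.
Qed.

Lemma sage_hits_rcons x y : sage_hits C eta (rcons x y) =
  sage_hits C eta x + sage_marg C eta x y.
Proof. by rewrite /sage_hits sage_hits_from_rcons. Qed.

(** Each round moves one request into the history of one context and raises the SAGE hits there by
    the marginal just earned. The induction needs [past] arbitrary. *)
Lemma msage_hitsE s past x :
  msage_hits C eta s past x + \sum_s' sage_hits C eta (requests_at past s') =
  \sum_s' sage_hits C eta (requests_at (past ++ markov_trace s x) s').
Proof.
elim: x s past => [|y ys IH] s past /=; first by rewrite add0r cats0.
rewrite -cat_rcons -IH addrAC addrC; congr (_ + _).
rewrite [in RHS](bigD1 s)//= [in LHS](bigD1 s)//= addrA; congr (_ + _).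
  rewrite /requests_at filter_rcons eqxx map_rcons sage_hits_rcons.
  by rewrite addrC.
apply: eq_bigr => s' /negPf ss'.
by rewrite /requests_at filter_rcons /= eq_sym ss'.
Qed.

Lemma msage_hits_trace s x : msage_hits C eta s [::] x =
  \sum_s' sage_hits C eta (requests_at (markov_trace s x) s').
Proof.
rewrite -(msage_hitsE s [::] x) big1 ?addr0// => s' _.
Qed.

Lemma sage_marg_ge0 h y : 0 <= sage_marg C eta h y.
Proof.
have w0 i : 0 <= sage_weights eta h i by exact: expR_ge0.
rewrite /sage_marg divr_ge0 ?mulr_ge0//; apply: sumr_ge0 => A _;
  exact: prodr_ge0.
Qed.

Lemma msage_hits_ge0 (s : state) past x : 0 <= msage_hits C eta s past x.
Proof.
by elim: x s past => //= y ys IH s past; rewrite addr_ge0 ?sage_marg_ge0.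
Qed.

(** The number [P] of the introductory comment. *)
Definition context_best s x : nat :=
  (\sum_s' best_fixed_hits C (requests_at (markov_trace s x) s'))%N.

Lemma best_fixed_hits_le_size (ys : seq 'I_N) : (best_fixed_hits C ys <= size ys)%N.
Proof. by apply/bigmax_leqP => A _; exact: count_size. Qed.

Lemma context_best_le_size s x : (context_best s x <= size x)%N.
Proof.
rewrite -(size_markov_trace s x) -sum_size_requests_at.
by apply: leq_sum => s' _; exact: best_fixed_hits_le_size.
Qed.

Lemma context_best_ge s x : (0 < C)%N -> (C <= N)%N ->
  (C * size x <= N * context_best s x)%N.
Proof.
move=> C0 CN; rewrite -(size_markov_trace s x) -sum_size_requests_at !big_distrr/=.
by apply: leq_sum => s' _; exact: best_fixed_hits_ge.
Qed.

Lemma fsp_hits_markov_le (f : state -> {ffun {set 'I_N} -> R}) s x :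
  (forall s', is_cache_dist C (f s')) ->
  fsp_hits (@markov_next N k) f s x <= (context_best s x)%:R.
Proof.
move=> fC; rewrite fsp_hits_markov (@sum_requests_at R (fun s y => hit_prob (f s) y)).
by rewrite natr_sum; apply: ler_sum => s' _; exact: sum_hit_prob_le.
Qed.

Lemma exists_cache_dist : (C <= N)%N -> exists d : {ffun {set 'I_N} -> R}, is_cache_dist C d.
Proof.
move=> CN; have /card_gt0P[A] : (0 < #|[set A : {set 'I_N} | #|A| == C]|)%N.
  by rewrite card_draws card_ord bin_gt0.
rewrite inE => /eqP AC; exists [ffun B => (B == A)%:R]; split=> [B||B].
- by rewrite ffunE.
- rewrite (bigD1 A)//= ffunE eqxx big1 ?addr0// => B /negPf BA.
  by rewrite ffunE BA.
- by rewrite ffunE; have [->//|_] := eqVneq B A; rewrite eqxx.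
Qed.

Lemma Lstar_ge s x : (C <= N)%N ->
  (size x)%:R - (context_best s x)%:R <= Lstar C s x :> R.
Proof.
move=> CN; apply: lb_le_inf.
  (* The infimum is bounded below by a lower bound only if the set is nonempty, so a Markov
     prefetcher is exhibited. *)
  have [d dC] := exists_cache_dist CN.
  by exists ((size x)%:R - fsp_hits (@markov_next N k) (fun=> d) s x), (fun=> d).
by move=> r [f [fC ->]]; rewrite lerD2l lerN2 fsp_hits_markov_le.
Qed.

Lemma lnNeCE : (0 < C)%N -> (C <= N)%N -> lnNeC N C = 1 + ln (N%:R / C%:R) :> R.
Proof.
move=> C0 CN; have N0 : (0 < N)%N by exact: leq_trans CN.
rewrite /lnNeC mulrAC lnM ?posrE ?divr_gt0 ?ltr0n ?expR_gt0//.
by rewrite expRK addrC.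
Qed.

Lemma lnNeC_ge1 : (0 < C)%N -> (C <= N)%N -> 1 <= lnNeC N C :> R.
Proof.
move=> C0 CN; rewrite lnNeCE// lerDl ln_ge0//.
by rewrite ler_pdivlMr ?ltr0n// mul1r ler_nat.
Qed.

Lemma msage_hits_ge s x : (0 < C)%N -> (C <= N)%N -> sage_guarantee C eta ->
  (context_best s x)%:R -
    Num.sqrt (2 * (N ^ k)%:R * C%:R *
      ((size x)%:R - (context_best s x)%:R) * lnNeC N C) -
    (N ^ k)%:R * C%:R * lnNeC N C <= msage_hits C eta s [::] x.
Proof.
move=> C0 CN sg; rewrite msage_hits_trace.
have L0 : 0 <= lnNeC N C :> R by have := lnNeC_ge1 C0 CN; lra.
have cs : #|{: state}| = (N ^ k)%N by rewrite card_ffun !card_ord.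
pose ys s' := requests_at (markov_trace s x) s'.
pose l s' := (size (ys s') - best_fixed_hits C (ys s'))%N.
apply: (@le_trans _ _ (\sum_s' ((best_fixed_hits C (ys s'))%:R -
    Num.sqrt (2 * C%:R * (l s')%:R * lnNeC N C) - C%:R * lnNeC N C))); last first.
  by apply: ler_sum => s' _; exact: sg.
rewrite !big_split/= -natr_sum !sumrN lerB//; last first.
  by rewrite sumr_const cs -[leLHS]mulr_natl !mulrA.
rewrite lerB//.
have l0 s' : 0 <= 2 * C%:R * (l s')%:R * lnNeC N C :> R by rewrite !mulr_ge0.
rewrite (le_trans (sum_sqrt_le l0))// ler_wsqrtr// cs -mulr_suml -mulr_sumr -natr_sum.
have -> : (\sum_s' l s' = size x - context_best s x)%N.
  rewrite -(size_markov_trace s x) -sum_size_requests_at sumnB// => s' _.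
  exact: best_fixed_hits_le_size.
rewrite natrB ?context_best_le_size//.
by rewrite le_eqVlt; apply/orP; left; apply/eqP; ring.
Qed.

End trace.

(** * Hedge on windows *)

Section hedge.
Variables (R : realType) (N C : nat) (St : finType).
Variables (g : St -> 'I_N -> St) (f : St -> {ffun {set 'I_N} -> R}).
Hypothesis fC : forall q, is_cache_dist C (f q).
Variables (c : R).
Hypothesis c0 : 0 < c.
Variable y0 : 'I_N.

Lemma fsp_hits_cat q a b :
  fsp_hits g f q (a ++ b) = fsp_hits g f q a + fsp_hits g f (foldl g q a) b.
Proof. by elim: a q => [|y a IH] q /=; rewrite ?add0r// IH addrA. Qed.

Lemma fsp_hits_rcons q w y :
  fsp_hits g f q (rcons w y) = fsp_hits g f q w + hit_prob (f (foldl g q w)) y.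
Proof. by rewrite -cats1 fsp_hits_cat /= addr0. Qed.

Lemma fsp_hits_sum q w : fsp_hits g f q w =
  \sum_(0 <= t < size w) hit_prob (f (foldl g q (take t w))) (nth y0 w t).
Proof.
elim: w q => [|y w IH] q /=; first by rewrite big_geq.
by rewrite big_nat_recl//= IH.
Qed.

Lemma fsp_hits_le_size q w : fsp_hits g f q w <= (size w)%:R.
Proof.
elim: w q => [|y w IH] q //=; rewrite -natr1 addrC lerD//.
exact: hit_prob_le1 (fC q).
Qed.

(* Exponential weights where every state is an expert: expert [q] predicts
   what the machine would cache had it been in state [q] before [w]. *)
Definition expert_weight (w : seq 'I_N) (q : St) : R := expR (c * fsp_hits g f q w).
Definition total_weight w := \sum_q expert_weight w q.
Definition hedge w y : R :=
  (\sum_q expert_weight w q * hit_prob (f (foldl g q w)) y) / total_weight w.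
Definition hedge_hits w : R :=
  \sum_(0 <= i < size w) hedge (take i w) (nth y0 w i).

Lemma expert_weight_gt0 w q : 0 < expert_weight w q.
Proof. exact: expR_gt0. Qed.

Lemma expert_weight_le_total w q : expert_weight w q <= total_weight w.
Proof.
rewrite /total_weight (bigD1 q)//= lerDl.
by apply: sumr_ge0 => q' _; exact/ltW/expert_weight_gt0.
Qed.

Lemma hedge_hits_rcons w y : hedge_hits (rcons w y) = hedge_hits w + hedge w y.
Proof.
rewrite /hedge_hits size_rcons big_nat_recr//=; congr (_ + _).
  apply: eq_big_nat => i /andP[_ iw].
  by rewrite nth_rcons iw -cats1 takel_cat// ltnW.
by rewrite nth_rcons ltnn eqxx -cats1 takel_cat// take_size.
Qed.

Section nonempty.
Variable q0 : St.

Lemma total_weight_gt0 w : 0 < total_weight w.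
Proof. exact: lt_le_trans (expert_weight_gt0 w q0) (expert_weight_le_total w q0). Qed.

Lemma hedge_ge w y q :
  expert_weight w q / total_weight w * hit_prob (f (foldl g q w)) y <= hedge w y.
Proof.
rewrite mulrAC /hedge ler_wpM2r ?invr_ge0 ?(ltW (total_weight_gt0 w))//.
rewrite (bigD1 q)//= lerDl; apply: sumr_ge0 => q' _.
by rewrite mulr_ge0 ?(hit_prob_ge0 _ (fC _))// ltW ?expert_weight_gt0.
Qed.

Lemma hedge_ge0 w y : 0 <= hedge w y.
Proof.
rewrite /hedge divr_ge0 ?(ltW (total_weight_gt0 w))//; apply: sumr_ge0 => q _.
by rewrite mulr_ge0 ?(hit_prob_ge0 _ (fC _))// ltW ?expert_weight_gt0.
Qed.

Lemma hedge_le1 w y : hedge w y <= 1.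
Proof.
rewrite ler_pdivrMr ?total_weight_gt0// mul1r; apply: ler_sum => q _.
by rewrite ler_piMr ?(hit_prob_le1 _ (fC _))// ltW ?expert_weight_gt0.
Qed.

(** [expR_le_chord] makes the factor of each expert affine in its hit probability, so that the sum
    depends on [hedge w y] alone and [bernoulli_mgf_le] applies. *)
Lemma total_weight_rcons w y : total_weight (rcons w y) <=
  total_weight w * expR (c * hedge w y + c ^+ 2 / 8).
Proof.
have Z0 := total_weight_gt0 w.
apply: (@le_trans _ _ (total_weight w * (1 - hedge w y + hedge w y * expR c))).
  rewrite mulrDr mulrBr mulr1 mulrA.
  have -> : total_weight w * hedge w y =
      \sum_q expert_weight w q * hit_prob (f (foldl g q w)) y.
    by rewrite mulrC divfK// gt_eqF.
  rewrite -sumrB mulr_suml -big_split/=; apply: ler_sum => q _.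
  rewrite {1}/expert_weight fsp_hits_rcons mulrDr expRD.
  rewrite -[X in X - _]mulr1 -mulrBr -mulrA -mulrDr ler_wpM2l ?expR_ge0//.
  by apply: expR_le_chord; [exact: hit_prob_ge0 (fC _)|exact: hit_prob_le1 (fC _)].
rewrite ler_wpM2l ?(ltW Z0)//.
by apply: bernoulli_mgf_le; [exact: hedge_ge0|exact: hedge_le1|exact: ltW].
Qed.

Lemma total_weight_le w : total_weight w <=
  #|St|%:R * expR (c * hedge_hits w + (size w)%:R * (c ^+ 2 / 8)).
Proof.
elim/last_ind: w => [|w y IH].
  rewrite /hedge_hits big_geq// mulr0 mul0r addr0 expR0 mulr1.
  rewrite /total_weight (eq_bigr (fun=> 1)) ?sumr_const//.
  by move=> q _; rewrite /expert_weight /= mulr0 expR0.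
rewrite (le_trans (total_weight_rcons w y))//.
rewrite hedge_hits_rcons size_rcons -[(size w).+1%:R]natr1.
rewrite [X in _ <= _ * expR X](_ : _ = (c * hedge_hits w + (size w)%:R * (c ^+ 2 / 8)) +
  (c * hedge w y + c ^+ 2 / 8)); last by ring.
by rewrite [in leRHS]expRD [leRHS]mulrA ler_wpM2r ?expR_ge0.
Qed.

(* The last round is not charged to the potential: if [q] has share [v] of the
   weight then the round costs at most [1 - v], while the potential bound gains
   [- ln v / c]. *)
Lemma hedge_regret (k : nat) (D : R) w q : (size w <= k.+1)%N ->
  (forall v, 0 < v -> v <= 1 -> ln v / c + 1 - v <= D) ->
  fsp_hits g f q w - hedge_hits w <= ln #|St|%:R / c + k%:R * c / 8 + D.
Proof.
move=> wk HD.
have St0 : 0 < #|St|%:R :> R by rewrite ltr0n; apply/card_gt0P; exists q.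
have D0 : 0 <= D by have := HD 1 ltr01 (lexx _); rewrite ln1 mul0r add0r subrr.
have kc0 : 0 <= k%:R * c / 8 by rewrite divr_ge0// mulr_ge0// ltW.
case/lastP: w wk => [_|w y].
  rewrite /= /hedge_hits big_geq// subrr !addr_ge0// divr_ge0 ?(ltW c0)//.
  by rewrite ln_ge0// ler1n -(ltr0n R).
rewrite size_rcons ltnS fsp_hits_rcons hedge_hits_rcons => wk.
pose v := expert_weight w q / total_weight w.
have Z0 := total_weight_gt0 w.
have v0 : 0 < v by rewrite divr_gt0// expert_weight_gt0.
have v1 : v <= 1 by rewrite ler_pdivrMr// mul1r expert_weight_le_total.
have hv := hedge_ge w y q; rewrite -/v in hv.
have := hit_prob_le1 y (fC (foldl g q w)); have := hit_prob_ge0 y (fC (foldl g q w)).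
move: (hit_prob _ _) hv => h hv h0 h1.
have lnv : c * fsp_hits g f q w = ln v + ln (total_weight w).
  by rewrite /v ln_div ?posrE// ?expert_weight_gt0// subrK /expert_weight expRK.
have lnZ : ln (total_weight w) <=
    ln #|St|%:R + c * hedge_hits w + k%:R * (c ^+ 2 / 8).
  apply: (@le_trans _ _ (ln (#|St|%:R *
      expR (c * hedge_hits w + (size w)%:R * (c ^+ 2 / 8))))).
    by rewrite ler_ln ?posrE ?total_weight_le// mulr_gt0// expR_gt0.
  rewrite lnM ?posrE ?expR_gt0// expRK addrA lerD2l ler_wpM2r ?ler_nat//.
  by rewrite divr_ge0// sqr_ge0.
have {HD} := HD v v0 v1.
have -> : fsp_hits g f q w = (ln v + ln (total_weight w)) / c.
  by rewrite -lnv mulrC mulKf// gt_eqF.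
have : (ln v + ln (total_weight w)) / c <=
    ln v / c + ln #|St|%:R / c + hedge_hits w + k%:R * c / 8.
  rewrite ler_pdivrMr//.
  have -> : (ln v / c + ln #|St|%:R / c + hedge_hits w + k%:R * c / 8) * c =
    ln v + (ln #|St|%:R + c * hedge_hits w + k%:R * (c ^+ 2 / 8)).
    by field; rewrite gt_eqF.
  by rewrite lerD2l.
move: (_ / c) (_ / c) (_ / c) (k%:R * c / 8) => X1 X2 X3 X4.
have : h - v * h <= 1 - v by nra.
lra.
Qed.
End nonempty.
End hedge.

(** * Markov states as words of recent requests *)

Section context.
Variables (N k : nat).
Notation state := {ffun 'I_k -> 'I_N}.

Definition context_word (s : state) : seq 'I_N := [seq s i | i <- enum 'I_k].

(* The state lists the latest request first; [context_suffix j s] is its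
   [j] latest requests in chronological order. *)
Definition context_suffix (j : nat) (s : state) : seq 'I_N :=
  rev (take j (context_word s)).

Lemma size_context_word s : size (context_word s) = k.
Proof. by rewrite size_map size_enum_ord. Qed.

Lemma context_word_next s y :
  context_word (markov_next s y) = take k (y :: context_word s).
Proof.
apply: (@eq_from_nth _ y).
  by rewrite size_context_word size_take /= size_context_word ltnS leqnn.
move=> i; rewrite size_context_word => ik.
rewrite nth_take// (nth_map (Ordinal ik)) ?size_enum_ord//.
have -> : nth (Ordinal ik) (enum 'I_k) i = Ordinal ik by apply: val_inj; rewrite /= nth_enum_ord.
rewrite ffunE /=; case: i ik => [|i] ik //=.
have ik' := ltnW ik.
rewrite (nth_map (Ordinal ik)) ?size_enum_ord//; congr (s _).
apply: val_inj; rewrite /= nth_enum_ord//.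
by rewrite val_insubd ik'.
Qed.

Lemma context_word_foldl s w :
  context_word (foldl (@markov_next N k) s w) = take k (rev w ++ context_word s).
Proof.
elim/last_ind: w => [|w y IH]; first by rewrite /= take_oversize// size_context_word.
rewrite foldl_rcons context_word_next IH rev_rcons /=.
case: (k) => [|m] //=.
by rewrite take_takel.
Qed.

(** This lets a Markov prefetcher of order [k] run Hedge at position [j <= k] of a window: its state
    holds the whole window so far. *)
Lemma context_suffix_foldl s w j : (j <= k)%N -> (j <= size w)%N ->
  context_suffix j (foldl (@markov_next N k) s w) = drop (size w - j) w.
Proof.
move=> jk jw; rewrite /context_suffix context_word_foldl take_takel//.
by rewrite takel_cat ?size_rev// take_rev revK.
Qed.

End context.

(** * Averaging Hedge over the positions in a window *)

Section markov_hedge.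
Variables (R : realType) (N C k : nat) (St : finType).
Variables (g : St -> 'I_N -> St) (f : St -> {ffun {set 'I_N} -> R}).
Hypothesis fC : forall q, is_cache_dist C (f q).
Variables (c : R) (D : R).
Hypothesis c0 : 0 < c.
Hypothesis HD : forall v, 0 < v -> v <= 1 -> ln v / c + 1 - v <= D.
Variable y0 : 'I_N.
Variable q0 : St.

Notation state := {ffun 'I_k -> 'I_N}.

(** The state does not tell the position within a window, so [j] is drawn uniformly and Hedge plays
    as if its window had begun [j] requests ago. *)
Definition markov_hedge (s : state) : {ffun {set 'I_N} -> R} :=
  [ffun A => (k.+1)%:R^-1 * \sum_(j < k.+1) \sum_q
    expert_weight g f c (context_suffix j s) q /
    total_weight g f c (context_suffix j s) *
    f (foldl g q (context_suffix j s)) A].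

Lemma sum_expert_share w : \sum_q expert_weight g f c w q / total_weight g f c w = 1.
Proof.
by rewrite -mulr_suml divff// gt_eqF// (total_weight_gt0 g f c q0).
Qed.

Lemma markov_hedge_cache_dist s : is_cache_dist C (markov_hedge s).
Proof.
have share0 w q : 0 <= expert_weight g f c w q / total_weight g f c w.
  by rewrite divr_ge0// ltW ?expert_weight_gt0// (total_weight_gt0 g f c q0).
split=> [A||A].
- rewrite ffunE mulr_ge0 ?invr_ge0//; apply: sumr_ge0 => j _; apply: sumr_ge0 => q _.
  by rewrite mulr_ge0//; case: (fC (foldl g q (context_suffix j s))).
- under eq_bigr do rewrite ffunE.
  rewrite -mulr_sumr exchange_big/= (eq_bigr (fun=> 1)).
    by rewrite sumr_const card_ord mulVf// pnatr_eq0.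
  move=> j _; rewrite exchange_big/= -(sum_expert_share (context_suffix j s)).
  apply: eq_bigr => q _; rewrite -mulr_sumr.
  by case: (fC (foldl g q (context_suffix j s))) => _ -> _; rewrite mulr1.
- apply: contra_neqP => /eqP AC; rewrite ffunE big1 ?mulr0// => j _.
  rewrite big1// => q _; apply/eqP; rewrite mulf_eq0; apply/orP; right.
  apply/negPn/negP => fA; case: (fC (foldl g q (context_suffix j s))) => _ _ /(_ A fA).
  by move/eqP; apply/negP.
Qed.

Lemma hit_prob_markov_hedge s y : hit_prob (markov_hedge s) y =
  (k.+1)%:R^-1 * \sum_(j < k.+1) hedge g f c (context_suffix j s) y.
Proof.
rewrite /hit_prob; under eq_bigr do rewrite ffunE.
rewrite -mulr_sumr exchange_big/=; congr (_ * _); apply: eq_bigr => j _.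
rewrite exchange_big/= /hedge mulr_suml; apply: eq_bigr => q _.
by rewrite -mulr_sumr mulrAC.
Qed.

Section stream.
Variables (x : seq 'I_N) (s0 : state).

Let hits t := hit_prob (f (foldl g q0 (take t x))) (nth y0 x t).
Let hedged t j := hedge g f c (drop (t - j) (take t x)) (nth y0 x t).
Let W : R := ln #|St|%:R / c + k%:R * c / 8 + D.

(** The good expert is the state that the prefetcher really has at time [t0]. The condition on [j]
    cuts off windows that run past the last request. *)
Lemma window_regret t0 : (t0 <= size x)%N ->
  \sum_(0 <= j < k.+1 | (j + t0 < size x)%N) (hits (j + t0) - hedged (j + t0) j) <= W.
Proof.
move=> t0x; set w := take k.+1 (drop t0 x).
have sw : size w = minn k.+1 (size x - t0) by rewrite size_take_min size_drop.
have := @hedge_regret R N C St g f fC c c0 y0 q0 k D w (foldl g q0 (take t0 x)).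
rewrite sw geq_minl => /(_ isT HD); apply: le_trans.
rewrite (fsp_hits_sum _ _ y0) /hedge_hits -sumrB sw.
have tw j : (j < minn k.+1 (size x - t0))%N -> take j w = drop t0 (take (j + t0) x).
  by rewrite leq_min => /andP[jk _]; rewrite take_takel 1?ltnW// take_drop.
rewrite [leRHS](eq_big_nat _ _ (F2 := fun j => hits (j + t0) - hedged (j + t0) j)).
  rewrite [leRHS](big_nat_widen _ _ k.+1) ?geq_minl// le_eqVlt; apply/orP; left; apply/eqP.
  rewrite [LHS]big_nat_cond [RHS]big_nat_cond; apply: eq_bigl => j /=.
  rewrite leq_min. apply/idP/idP; lia.
move=> j /= jw; rewrite tw// /hits /hedged addnC addnK.
rewrite -foldl_cat.
have -> : take t0 x ++ drop t0 (take (t0 + j) x) = take (t0 + j) x.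
  by rewrite takeD; congr (_ ++ _); rewrite -takeD take_drop addnC.
by move: jw; rewrite leq_min => /andP[jk _]; rewrite nth_take// nth_drop.
Qed.

Lemma hedged_context t j : (t < size x)%N -> (j <= t)%N -> (j <= k)%N ->
  hedge g f c (context_suffix j (foldl (@markov_next N k) s0 (take t x))) (nth y0 x t)
  = hedged t j.
Proof.
move=> tx jt jk; rewrite context_suffix_foldl// size_takel//; exact: ltnW.
Qed.

(* Every position [j] of a window is charged to the window starting [j] rounds
   earlier; the [k (k + 1) / 2] pairs whose window would start before the first
   request are charged 1. *)
Lemma markov_hedge_regret :
  (k.+1)%:R * (fsp_hits g f q0 x - fsp_hits (@markov_next N k) markov_hedge s0 x) <=
  (size x)%:R * W + (k * k.+1)%:R / 2.
Proof.
have k0 : (k.+1)%:R != 0 :> R by rewrite pnatr_eq0.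
(* For [t < j] the suffix still contains entries of [s0]; [mu t j] is identified with [hedged t j]
   only for [j <= t]. *)
pose mu t j := hedge g f c (context_suffix j (foldl (@markov_next N k) s0 (take t x)))
  (nth y0 x t).
have -> : (k.+1)%:R * (fsp_hits g f q0 x - fsp_hits (@markov_next N k) markov_hedge s0 x) =
    \sum_(0 <= j < k.+1) \sum_(0 <= t < size x) (hits t - mu t j).
  rewrite !(fsp_hits_sum _ _ y0) -sumrB mulr_sumr exchange_big/=.
  apply: eq_bigr => t _; rewrite hit_prob_markov_hedge mulrBr mulrA divff// mul1r.
  by rewrite sumrB big_mkord sumr_const card_ord mulr_natl [in RHS]big_mkord.
have step j : (j < k.+1)%N -> \sum_(0 <= t < size x) (hits t - mu t j) <=
    j%:R + \sum_(j <= t < size x) (hits t - hedged t j).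
  move=> jk.
  have le1 t : hits t - mu t j <= 1.
    have := hit_prob_le1 (nth y0 x t) (fC (foldl g q0 (take t x))).
    have := hedge_ge0 g fC c q0 (context_suffix j (foldl (@markov_next N k) s0 (take t x))) (nth y0 x t).
    by rewrite /hits /mu; lra.
  have sum1 m : \sum_(0 <= t < m) (hits t - mu t j) <= m%:R.
    apply: (@le_trans _ _ (\sum_(0 <= t < m) 1)); first exact: ler_sum.
    by rewrite big_const_nat subn0 iter_addr_0.
  have [jx|xj] := leqP j (size x); last first.
    by rewrite [X in _ + X]big_geq 1?ltnW// addr0 (le_trans (sum1 _))// ler_nat ltnW.
  rewrite (big_cat_nat _ jx)//= lerD// le_eqVlt; apply/orP; left; apply/eqP.
  apply: eq_big_nat => t /andP[jt tx]; congr (_ - _).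
  by rewrite /mu hedged_context.
apply: (@le_trans _ _ (\sum_(0 <= j < k.+1) (j%:R +
    \sum_(j <= t < size x) (hits t - hedged t j)))).
  by apply: ler_sum_nat => j /andP[_ jk]; exact: step.
rewrite big_split/= addrC lerD//; last first.
  rewrite le_eqVlt; apply/orP; left; apply/eqP.
  elim: (k) => [|m IH]; first by rewrite big_nat1 mul0n mul0r.
  by rewrite big_nat_recr//= IH !natrM -!natr1; field.
(* Reindexing by the start [t - j] of the window groups the terms into window regrets. *)
have -> : \sum_(0 <= j < k.+1) \sum_(j <= t < size x) (hits t - hedged t j) =
  \sum_(0 <= t < size x) \sum_(0 <= j < k.+1 | (j + t < size x)%N)
     (hits (j + t) - hedged (j + t) j).
  rewrite (exchange_big_dep predT)//=; apply: eq_bigr => j _.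
  rewrite -[j in \sum_(j <= _ < _) _]add0n big_addn.
  rewrite (big_nat_widen _ _ (size x)) ?leq_subr//= big_nat_cond [RHS]big_nat_cond.
  apply: eq_big => [t|t _]; last by rewrite addnC.
  by rewrite /=; case: ltnP => //= _; lia.
apply: (@le_trans _ _ (\sum_(0 <= t < size x) W)).
  by apply: ler_sum_nat => t /andP[_ tx]; apply: window_regret; exact: ltnW.
by rewrite big_const_nat subn0 iter_addr_0 mulr_natl.
Qed.
End stream.
End markov_hedge.

(** * The two bounds on the hit gap *)

(** For [c <= 1], [ln v <= v - 1 <= c (v - 1)]. For [c > 1] the tangent at [v = 1 / c] is used in
    the form [ln (c v) <= c v - 1]. *)
Lemma last_round_boundP (R : realType) (c v : R) : 0 < c -> 0 < v -> v <= 1 ->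
  ln v / c + 1 - v <= last_round_bound c.
Proof.
move=> c0 v0 v1; rewrite /last_round_bound.
have ln_le (u : R) : 0 < u -> ln u <= u - 1.
  by move=> u0; have := @le_ln1Dx R (u - 1); rewrite [1 + _]addrC subrK; apply; lra.
case: ifPn => [c1|]; last rewrite -ltNge => c1.
  suff : ln v / c <= v - 1 by lra.
  by rewrite ler_pdivrMr//; have := ln_le v v0; nra.
have H1 := ln_le (c * v) (mulr_gt0 c0 v0).
rewrite lnM ?posrE// in H1.
have H2 := ln_ge_pade (ltW c1).
have -> : (c - 1) ^+ 2 / (c * (c + 1)) = (- 1 - 2 * (c - 1) / (c + 1)) / c + 1.
  by field; lra.
suff : ln v / c - v <= (- 1 - 2 * (c - 1) / (c + 1)) / c by lra.
rewrite ler_pdivlMr// mulrBl divfK ?gt_eqF//; lra.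
Qed.

(** Settles [S = 1], where [ln S = 0] leaves no positive rate for Hedge. *)
Lemma fsp_hits_subsingleton (R : realType) (N k : nat) (St : finType)
    (g : St -> 'I_N -> St) (f : St -> {ffun {set 'I_N} -> R}) q
    (s : {ffun 'I_k -> 'I_N}) (x : seq 'I_N) : (#|St| <= 1)%N ->
  fsp_hits g f q x = fsp_hits (@markov_next N k) (fun=> f q) s x.
Proof.
move=> /card_le1_eqP St1.
have E q' : q' = q by apply: St1.
by elim: x s => //= y ys IH s; rewrite -(IH (markov_next s y)) (E (g q y)).
Qed.

(** Since [N >= 2], [N^k >= 2^k]. The other factor is [1 + ln N >= 1 + ln 2 > 27/16] if [C = 1], and
    at least 2 otherwise. *)
Lemma regret_cost_ge (R : realType) (N C k : nat) : (0 < C)%N -> (C < N)%N ->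
  (27/16) * 2 ^+ k <= (N ^ k)%:R * C%:R * lnNeC N C :> R.
Proof.
move=> C0 CN; have L1 := @lnNeC_ge1 N R C C0 (ltnW CN).
have CL : 27/16 <= C%:R * lnNeC N C :> R.
  have [C1|C2] : C = 1%N \/ (2 <= C)%N by lia.
    subst C; rewrite lnNeCE ?(ltnW CN)// mul1r divr1.
    have : ln 2 <= ln N%:R :> R by rewrite ler_ln ?posrE ?ltr0n ?ler_nat// ltnW.
    by have := ln2_gt R; lra.
  have : 2 <= C%:R :> R by rewrite ler_nat.
  by nra.
have K2 : 2 ^+ k <= (N ^ k)%:R :> R.
  rewrite -natrX ler_nat; case: (k) => // k'.
  by rewrite leq_exp2r // (leq_ltn_trans C0 CN).
rewrite mulrC -mulrA ler_pM//.
Qed.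

(** The rate [c = 4 e] balances [ln S / c] against [(k + 1) c / 8]. With [D = last_round_bound c] a
    window costs at most [(k + 1) e / 2 + k e / 2 + D = (k + 1) e - (e / 2 - D)], and [e / 2 - D] is
    the gain that pays for [k (k + 1)]. *)
Lemma markov_gap (R : realType) (N C k S : nat) (St : finType)
    (g : St -> 'I_N -> St) (f : St -> {ffun {set 'I_N} -> R}) (q0 : St)
    (s0 : {ffun 'I_k -> 'I_N}) (x : seq 'I_N) (e : R) :
  (forall q, is_cache_dist C (f q)) -> (#|St| <= S)%N -> 0 < e ->
  ln S%:R = 2 * (k.+1)%:R * e ^+ 2 ->
  2 * (k.+1)%:R * (fsp_hits g f q0 x - (context_best C s0 x)%:R) <=
  2 * (k.+1)%:R * ((size x)%:R * e) -
  2 * (size x)%:R * (e / 2 - last_round_bound (4 * e)) + (k * k.+1)%:R.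
Proof.
move=> fC StS e0 eS.
have [->|x0] := eqVneq x [::].
  by rewrite /= !(mul0r, mulr0) !sub0r oppr0 add0r (@le_trans _ _ 0)// mulr_ge0_le0// oppr_le0.
have y0 : 'I_N by case: x x0.
have c0 : 0 < 4 * e by rewrite mulr_gt0.
have := markov_hedge_regret g fC c0 (fun v => @last_round_boundP R (4 * e) v c0) y0 q0 x s0.
have := fsp_hits_markov_le s0 x (@markov_hedge_cache_dist R N C k St g f fC (4 * e) q0).
move: (fsp_hits _ (markov_hedge _ _ _) _ _) => F' F'P.
have lnSt : ln #|St|%:R <= 2 * (k.+1)%:R * e ^+ 2.
  have St0 : (0 < #|St|)%N by apply/card_gt0P; exists q0.
  by rewrite -eS ler_ln ?posrE ?ltr0n ?ler_nat// (leq_trans St0).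
have : ln #|St|%:R / (4 * e) <= (k.+1)%:R * e / 2.
  by rewrite ler_pdivrMr//; lra.
move: (last_round_bound _) (ln _ / _) (fsp_hits _ _ _ _) F'P => D X F F'P XP.
have T0 : 0 <= (size x)%:R :> R by [].
have k0 : 0 <= k%:R :> R by [].
rewrite natrM -[(k.+1)%:R]natr1 in XP *; move: (size x)%:R (k%:R) (context_best _ _ _)%:R T0 k0 XP F'P.
move=> T K P T0 K0 XP F'P H.
have : (K + 1) * F' <= (K + 1) * P by rewrite ler_wpM2l//; lra.
have : T * X <= T * ((K + 1) * e / 2) by rewrite ler_wpM2l.
nra.
Qed.

(** Otherwise [boundary_absorbed] lets the gain in [markov_gap] cover the loss at the start, and the
    hit gap is at most [e * size x], against the assumption. *)
Lemma lt_sqrt_hit_gap (R : realType) (N C k S : nat) (x : seq 'I_N)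
    (St : finType) (g : St -> 'I_N -> St) (f : St -> {ffun {set 'I_N} -> R})
    (q0 : St) (s0 : {ffun 'I_k -> 'I_N}) (e := Num.sqrt (ln S%:R / (2 * (k.+1)%:R)) : R)
    (Q := (N ^ k)%:R * C%:R * lnNeC N C : R) :
  (0 < C)%N -> (C <= N)%N -> (#|St| <= S)%N -> (forall q, is_cache_dist C (f q)) ->
  e < 1 - C%:R / N%:R ->
  (size x)%:R * e < fsp_hits g f q0 x - (context_best C s0 x)%:R ->
  (1 - e) * (size x)%:R <= Q + Num.sqrt (2 * Q * (e * (size x)%:R)).
Proof.
move=> C0 CN StS fC eCN lt.
have N0 : 0 < N%:R :> R by rewrite ltr0n (leq_trans C0).
have CNr : 0 < C%:R / N%:R :> R by rewrite divr_gt0// ltr0n.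
have e_ge0 : 0 <= e by exact: sqrtr_ge0.
have [S1|S2] := leqP S 1.
  have := lt; rewrite (fsp_hits_subsingleton g f q0 s0 x (leq_trans StS S1)) => h.
  have := @fsp_hits_markov_le N k R C (fun=> f q0) s0 x (fun=> fC q0).
  by have := mulr_ge0 (ler0n R (size x)) e_ge0; lra.
have lnS : 11/16 <= ln S%:R :> R.
  have : ln 2 <= ln S%:R :> R by rewrite ler_ln ?posrE ?ltr0n ?ler_nat// ltnW.
  by have := ln2_gt R; lra.
have k0 : 0 < 2 * (k.+1)%:R :> R by rewrite mulr_gt0.
have eS : ln S%:R = 2 * (k.+1)%:R * e ^+ 2.
  rewrite sqr_sqrtr; first by rewrite mulrC divfK// gt_eqF.
  by rewrite divr_ge0// ?(ltW k0)//; lra.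
have e0 : 0 < e by rewrite sqrtr_gt0 divr_gt0//; lra.
have e1 : e < 1 by lra.
have C_lt_N : (C < N)%N.
  by rewrite -(ltr_nat R) -[ltRHS]mul1r -ltr_pdivrMr//; lra.
have := markov_gap g q0 s0 x fC StS e0 eS.
move=> gap; rewrite leNgt; apply/negP => lt2.
have he : 11/16 <= 2 * (k.+1)%:R * e ^+ 2 by rewrite -eS.
have := boundary_absorbed e0 e1 (ler0n R (size x)) he (regret_cost_ge R k C0 C_lt_N) lt2.
have : 2 * (k.+1)%:R * ((size x)%:R * e) <
  2 * (k.+1)%:R * (fsp_hits g f q0 x - (context_best C s0 x)%:R) by rewrite ltr_pM2l.
lra.
Qed.

Theorem theorem2 (R : realType) (N C T S k : nat) (x : seq 'I_N)
  (eta : seq 'I_N -> R) (s0 : {ffun 'I_k -> 'I_N})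
  (St : finType) (g : St -> 'I_N -> St) (f : St -> {ffun {set 'I_N} -> R})
  (q0 : St) :
  (1 <= N)%N -> (1 <= C)%N -> (C <= N)%N -> (1 <= T)%N -> (1 <= S)%N ->
  size x = T ->
  (forall h, 0 < eta h) -> sage_guarantee C eta ->
  (#|St| <= S)%N -> (forall q, is_cache_dist C (f q)) ->
  T%:R * (fsp_hit_rate g f q0 x - msage_hit_rate C eta s0 x)
  <= T%:R * Num.min (1 - C%:R / N%:R) (Num.sqrt (ln S%:R / (2 * (k.+1)%:R)))
     + Num.sqrt (2 * (N ^ k)%:R * C%:R * Lstar C s0 x * lnNeC N C)
     + (N ^ k)%:R * C%:R * lnNeC N C.
Proof.
move=> N1 C1 CN T1 S1 xT eta0 sg StS fC.
have T0 : T%:R != 0 :> R by rewrite pnatr_eq0 -lt0n.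
have -> : T%:R * (fsp_hit_rate g f q0 x - msage_hit_rate C eta s0 x) =
    fsp_hits g f q0 x - msage_hits C eta s0 [::] x.
  by rewrite /fsp_hit_rate /msage_hit_rate xT -mulrBl mulrC divfK.
have N0 : 0 < N%:R :> R by rewrite ltr0n.
have L0 : 0 <= lnNeC N C :> R by have := lnNeC_ge1 R C1 CN; lra.
set e := Num.sqrt (ln _ / _).
have hM := msage_hits_ge (R := R) s0 x C1 CN sg.
have hL := Lstar_ge R s0 x CN.
have hF := fsp_hits_le_size g fC q0 x.
have M0 := msage_hits_ge0 (R := R) C eta s0 [::] x.
have sqrt_le (r : R) : r <= Lstar C s0 x ->
    Num.sqrt (2 * (N ^ k)%:R * C%:R * r * lnNeC N C) <=
    Num.sqrt (2 * (N ^ k)%:R * C%:R * Lstar C s0 x * lnNeC N C).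
  by move=> rL; rewrite ler_wsqrtr// ler_wpM2r// ler_wpM2l// !mulr_ge0.
have sqrt_best := sqrt_le _ hL.
have [le|lt] := leP (1 - C%:R / N%:R) e.
  suff : (size x)%:R - (context_best C s0 x)%:R <= T%:R * (1 - C%:R / N%:R) :> R by lra.
  have : (C%:R * (size x)%:R / N%:R) <= (context_best C s0 x)%:R :> R.
    rewrite ler_pdivrMr// [leRHS]mulrC -!natrM ler_nat.
    exact: context_best_ge.
  by rewrite -xT mulrBr mulr1 mulrAC [C%:R / _ * _]mulrC; lra.
have [le2|lt2] := leP (fsp_hits g f q0 x - (context_best C s0 x)%:R) (T%:R * e).
  by lra.
(* Here [P < F - T e <= (1 - e) T], so Markov prefetchers miss at least [T e] requests. The regret
   terms are then at least [(1 - e) T], and [F <= T] with nonnegative SAGE hits suffices. *)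
rewrite -xT in lt2 *.
have := lt_sqrt_hit_gap C1 CN StS fC lt lt2.
have := sqrt_le (e * (size x)%:R).
have -> : 2 * (N ^ k)%:R * C%:R * (e * (size x)%:R) * lnNeC N C =
  2 * ((N ^ k)%:R * C%:R * lnNeC N C) * (e * (size x)%:R) by ring.
have : e * (size x)%:R <= Lstar C s0 x by rewrite mulrC; lra.
rewrite -/e => /[swap]/[apply]; lra.
Qed.
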